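(* For every integer $m\ge 1$, the adjacency matrix ${\cal T}^*_m$ of the digraph ${\cal D}^*_m$ is symmetric.
   Context: Alpha-letters (2-element subsets of the directions up, down, left, right): $a=\{\text{right},\text{down}\}$, $b=\{\text{up},\text{down}\}$, $c=\{\text{right},\text{up}\}$, $d=\{\text{left},\text{down}\}$, $e=\{\text{left},\text{right}\}$, $f=\{\text{left},\text{up}\}$. ${\cal D}_{ud}$: arc $(\alpha,\beta)$ iff ($\text{down}\in\alpha\iff\text{up}\in\beta$); ${\cal D}_{lr}$: arc $(\alpha,\beta)$ iff ($\text{right}\in\alpha\iff\text{left}\in\beta$). ${\cal D}_m$: vertices are the words $\alpha_1\cdots\alpha_m\in\{a,\dots,f\}^m$ with $(\alpha_i,\alpha_{i+1})$ an arc of ${\cal D}_{ud}$ for $1\le i\le m$ ($\alpha_{m+1}:=\alpha_1$); arc $v\to u$ iff $(v_i,u_i)$ is an arc of ${\cal D}_{lr}$ for all $i$. The outlet word $o(\alpha)\in\{0,1\}^m$ has $o_j=1$ iff $\alpha_j\in\{a,c,e\}$; the inlet word $i(\alpha)\in\{0,1\}^m$ has $i_j=1$ iff $\alpha_j\in\{d,e,f\}$. ${\cal D}^*_m$ is the directed multigraph obtained from ${\cal D}_m$ by merging all vertices with a common outlet word: its vertex set is $\{o(x):x\in V({\cal D}_m)\}$, and for vertices $v,w$ the number of arcs from $v$ to $w$ (the $(v,w)$-entry of ${\cal T}^*_m$) is $|\{y\in V({\cal D}_m): i(y)=v,\ o(y)=w\}|$. *)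

(* Defs.v *)
From HB Require Import structures.
From mathcomp Require Import all_boot all_order all_algebra.
Set Implicit Arguments.
Unset Strict Implicit.
Unset Printing Implicit Defensive.

Inductive direction := Up | Down | Left | Right.

Definition direction_to_ord (x : direction) : 'I_4 :=
  match x with
  | Up => @Ordinal 4 0 isT | Down => @Ordinal 4 1 isT
  | Left => @Ordinal 4 2 isT | Right => @Ordinal 4 3 isT
  end.

Definition ord_to_direction (i : 'I_4) : direction :=
  nth Up [:: Up; Down; Left; Right] i.

Lemma direction_to_ordK : cancel direction_to_ord ord_to_direction.
Proof. by case. Qed.

HB.instance Definition _ := Finite.copy direction (can_type direction_to_ordK).

Inductive letter := La | Lb | Lc | Ld | Le | Lf.

Definition letter_to_ord (x : letter) : 'I_6 :=
  match x with
  | La => @Ordinal 6 0 isT | Lb => @Ordinal 6 1 isT | Lc => @Ordinal 6 2 isT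
  | Ld => @Ordinal 6 3 isT | Le => @Ordinal 6 4 isT | Lf => @Ordinal 6 5 isT
  end.

Definition ord_to_letter (i : 'I_6) : letter :=
  nth La [:: La; Lb; Lc; Ld; Le; Lf] i.

Lemma letter_to_ordK : cancel letter_to_ord ord_to_letter.
Proof. by case. Qed.

HB.instance Definition _ := Finite.copy letter (can_type letter_to_ordK).

Definition dirs (x : letter) : {set direction} :=
  match x with
  | La => [set Right; Down]
  | Lb => [set Up; Down]
  | Lc => [set Right; Up]
  | Ld => [set Left; Down]
  | Le => [set Left; Right]
  | Lf => [set Left; Up]
  end.

Definition D_ud : rel letter :=
  fun x y => (Down \in dirs x) == (Up \in dirs y).

Definition D_lr : rel letter :=
  fun x y => (Right \in dirs x) == (Left \in dirs y).

(* [ordS i] is the cyclic successor i + 1 mod m. *)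
Definition D_vertices (m : nat) : {set m.-tuple letter} :=
  [set x | [forall i : 'I_m, D_ud (tnth x i) (tnth x (ordS i))]].

Definition D_arc (m : nat) : rel (m.-tuple letter) :=
  fun v u => [forall i : 'I_m, D_lr (tnth v i) (tnth u i)].

Definition outlet (m : nat) (x : m.-tuple letter) : m.-tuple bool :=
  [tuple tnth x j \in [:: La; Lc; Le] | j < m].

Definition inlet (m : nat) (x : m.-tuple letter) : m.-tuple bool :=
  [tuple tnth x j \in [:: Ld; Le; Lf] | j < m].

(* Why the arcs of the merged digraph are counted through inlet words: in D_m
   the arcs leaving v depend only on the outlet word of v. *)
Lemma D_arcE (m : nat) (v u : m.-tuple letter) :
  D_arc v u = (outlet v == inlet u).
Proof.
have R (x : letter) : (Right \in dirs x) = (x \in [:: La; Lc; Le]).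
  by case: x; rewrite !inE.
have L (x : letter) : (Left \in dirs x) = (x \in [:: Ld; Le; Lf]).
  by case: x; rewrite !inE.
apply/forallP/eqP => [H | H i].
  by apply: eq_from_tnth => i; rewrite !tnth_mktuple -R -L; apply/eqP/H.
by rewrite /D_lr R L; move/(congr1 (fun t => tnth t i)): H;
  rewrite !tnth_mktuple => ->.
Qed.

Definition Dstar_vertices (m : nat) : {set m.-tuple bool} :=
  [set outlet x | x in D_vertices m].

Definition Dstar_arcs (m : nat) (v w : m.-tuple bool) : nat :=
  #|[set y in D_vertices m | (inlet y == v) && (outlet y == w)]|.

(* Rows and columns are indexed by the enumeration of the vertex set. *)
Definition Tstar (m : nat) : 'M[nat]_(#|Dstar_vertices m|) :=
  \matrix_(i, j) Dstar_arcs (enum_val i) (enum_val j).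

(* Main.v *)
(** Exchanging left and right in every letter is an involution of the vertices of
    D_m (it fixes the up/down content) that swaps inlet and outlet words, so it
    matches the arcs v -> w of D*_m with the arcs w -> v. *)
Require Import Defs.
From mathcomp Require Import all_boot all_order all_algebra.

(** [Lb] contains neither [Left] nor [Right] and [Le] contains both, hence the two fixed letters. *)
Definition mirror (x : letter) : letter :=
  match x with
  | La => Ld | Lb => Lb | Lc => Lf | Ld => La | Le => Le | Lf => Lc
  end.

Lemma mirrorK : involutive mirror.
Proof. by case. Qed.

Lemma D_ud_mirror (x y : letter) : D_ud (mirror x) (mirror y) = D_ud x y.
Proof. by case: x; case: y; rewrite /D_ud !inE. Qed.

Definition mirror_word (m : nat) (x : m.-tuple letter) : m.-tuple letter :=
  map_tuple mirror x.

Lemma mirror_wordK (m : nat) : involutive (@mirror_word m).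
Proof.
by move=> x; apply: eq_from_tnth => i; rewrite !tnth_map mirrorK.
Qed.

Lemma mirror_word_vertices (m : nat) (x : m.-tuple letter) :
  (mirror_word m x \in D_vertices m) = (x \in D_vertices m).
Proof.
by rewrite !inE; apply: eq_forallb => i; rewrite !tnth_map D_ud_mirror.
Qed.

Lemma inlet_mirror (m : nat) (x : m.-tuple letter) :
  inlet (mirror_word m x) = outlet x.
Proof.
apply: eq_from_tnth => i; rewrite !tnth_mktuple tnth_map.
by case: (tnth x i).
Qed.

Lemma outlet_mirror (m : nat) (x : m.-tuple letter) :
  outlet (mirror_word m x) = inlet x.
Proof. by rewrite -inlet_mirror mirror_wordK. Qed.

Lemma Dstar_arcsC (m : nat) (v w : m.-tuple bool) :
  Dstar_arcs v w = Dstar_arcs w v.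
Proof.
(* The set counted on the left is replaced by its preimage under the injection [mirror_word], so
   equality can be checked elementwise. *)
rewrite /Dstar_arcs -(card_preimset _ (inv_inj (@mirror_wordK m))).
(* The invariance of vertices enters the goal first, so that [inE] unfolds it to the same form as in
   the two sets. *)
apply: eq_card => y; have := @mirror_word_vertices m y.
by rewrite !inE => ->; rewrite inlet_mirror outlet_mirror [X in _ && X]andbC.
Qed.

Theorem theorem1 (m : nat) (hm : 1 <= m) : trmx (Tstar m) = Tstar m.
Proof. by apply/matrixP => i j; rewrite !mxE Dstar_arcsC. Qed.
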